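(* Let $G$ be a connected graph and let $\alpha\in[1/2,1]$. Let $c(G)$ denote the circumference of $G$ (the length of a longest cycle in $G$). Then: (I) Let $k$ be even. (1) If $\lambda_{k}(A_{\alpha}(G))=2\alpha$, then $c(G)\leq 2k$; moreover equality $c(G)=2k$ (together with $\lambda_k(A_\alpha(G))=2\alpha$) occurs when $G=C_{4t}$ and $k=2t$ for $t\geq 2$. (2) If $\lambda_{k}(A_{\alpha}(G))<2\alpha$, then $c(G)\leq 2k-1$; moreover equality occurs when $G=C_{4t+3}$ and $k=2t+2$ for $t\geq 1$. (II) Let $k$ be odd. If $\lambda_{k}(A_{\alpha}(G))\leq 2\alpha$, then $c(G)\leq 2k-2$; moreover equality occurs when $G=C_{4t}$ and $k=2t+1$ for $t\geq 1$.
   Context: All graphs are finite, simple and undirected; $C_s$ is the cycle on $s$ vertices. For a graph $G$ with adjacency matrix $A(G)$ and diagonal degree matrix $D(G)$, and a real $\alpha\in[0,1]$, $A_{\alpha}(G)=\alpha D(G)+(1-\alpha)A(G)$. Its eigenvalues are denoted $\lambda_1(A_\alpha(G))\geq\cdots\geq\lambda_n(A_\alpha(G))$, where $n$ is the number of vertices.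
   Formalization: The bounds in (I)(1) and (II) and the equality case of (I)(2) are stated for α<1, since they fail at α=1: there A_1(G)=D(G), all eigenvalues of a cycle are 2, and C_5 (k=2, k=3) and C_7 (k=4) are counterexamples. All else is on [1/2,1], with 1≤k≤n and c(G)=0 for acyclic G. *)

(* Defs.v *)
From HB Require Import structures.
From mathcomp Require Import all_boot all_order all_algebra.
From mathcomp Require Import polyrcf reals.

Set Implicit Arguments.
Unset Strict Implicit.
Unset Printing Implicit Defensive.

Import Order.TTheory GRing.Theory Num.Theory.
Local Open Scope ring_scope.

Record sgraph := SGraph {
  vertex :> finType;
  adj : rel vertex;
  adj_sym : symmetric adj;
  adj_irrefl : irreflexive adj }.

Definition connected_graph (G : sgraph) : Prop :=
  forall x y : G, connect (@adj G) x y.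

Definition isomorphic (G H : sgraph) : Prop :=
  exists2 f : G -> H, bijective f & {mono f : x y / adj x y}.

(* The length of a longest cycle; it is 0 when G is acyclic. *)
Definition circumference (G : sgraph) : nat :=
  \max_(l < #|G|.+1 |
        [exists p : l.-tuple G, (2 < l)%N && ucycleb (@adj G) p]) l.

(* The conjunct i != j only matters for s = 1: it removes the loop. *)
Definition cycle_adj (s : nat) : rel 'I_s := fun i j =>
  (i != j) && ((j == i.+1 %% s :> nat) || (i == j.+1 %% s :> nat))%N.

Lemma cycle_adj_sym s : symmetric (@cycle_adj s).
Proof. by move=> i j; rewrite /cycle_adj eq_sym orbC. Qed.

Lemma cycle_adj_irrefl s : irreflexive (@cycle_adj s).
Proof. by move=> i; rewrite /cycle_adj eqxx. Qed.

(* This is the cycle C_s only for s >= 3. *)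
Definition cycle_graph (s : nat) : sgraph :=
  SGraph (@cycle_adj_sym s) (@cycle_adj_irrefl s).

Section Spectrum.
Variable R : realType.

Definition degree (G : sgraph) (x : G) : nat := #|[set y | adj x y]|.

(* Vertices are numbered by enum_val. *)
Definition adjacency_mx (G : sgraph) : 'M[R]_#|G| :=
  \matrix_(i, j) (adj (enum_val i) (enum_val j))%:R.

Definition degree_mx (G : sgraph) : 'M[R]_#|G| :=
  diag_mx (\row_i (degree (enum_val i))%:R).

Definition Aalpha (alpha : R) (G : sgraph) : 'M[R]_#|G| :=
  alpha *: degree_mx G + (1 - alpha) *: adjacency_mx G.

(* The real eigenvalues, each repeated according to its multiplicity as a root
   of the characteristic polynomial, in nonincreasing order (rootsR is sorted
   increasingly). For a symmetric matrix these are all n eigenvalues. *)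
Definition eigenvalues n (A : 'M[R]_n) : seq R :=
  let p := char_poly A in
  rev (flatten [seq nseq (mup x p) x | x <- rootsR p]).

(* Numbered from 1: lambda 1 A is the largest eigenvalue. *)
Definition lambda (k : nat) n (A : 'M[R]_n) : R := (eigenvalues A)`_k.-1.

End Spectrum.

(* Main.v *)
Require Import Defs.
From HB Require Import structures.
From mathcomp Require Import all_boot all_order all_algebra.
From mathcomp Require Import polyrcf reals complex ring lra zify.

Set Implicit Arguments.
Unset Strict Implicit.
Unset Printing Implicit Defensive.

Import Order.TTheory GRing.Theory Num.Theory.
Local Open Scope ring_scope.

(** By Courant-Fischer, lambda_k can be compared with a constant by exhibiting a
    subspace of the right dimension on which the quadratic form of the matrix has
    the required sign.  The form of A_alpha(G) is the sum over the edges uv of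
    alpha (x_u^2 + x_v^2) + 2 (1 - alpha) x_u x_v, which is nonnegative because
    alpha >= 1/2.  Hence, for x supported on a cycle C of G, it is at least the
    same sum over the edges of C alone, which is
    2 alpha |x|^2 + 2 (1 - alpha) q(x), where q(z) = z_0 z_1 + z_1 z_2 + ... cyclically;
    and there is equality when G = C.  Everything is thus reduced to finding
    subspaces on which q has a definite or semidefinite sign.

    Taking z constant, equal to a_i, on the disjoint edges {2i, 2i+1}, the form q
    becomes the sum of a_i^2 + a_i a_(i+1), which is half a sum of squares
    (a_i + a_(i+1))^2 plus boundary terms.  For cycles of length 2m+1 this is
    completed by one more vector, and for the upper bounds on C_4t one uses a
    totally isotropic subspace. *)

(** * Spectral theory of real symmetric matrices *)

Section SymmetricSpectrum.
Local Open Scope sesquilinear_scope.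
Variable R : realType.
Local Notation toC := (real_complex R).
Local Notation MtoC := (map_mx toC).

Lemma conj_map_real m n (M : 'M[R]_(m, n)) : (MtoC M)^t* = MtoC M^T.
Proof.
by apply/matrixP => i j; rewrite !mxE conj_Creal //; apply/complex_realP; exists (M j i).
Qed.

(** Unitary diagonalization of the complexified matrix: being hermitian, it has a real spectrum, so
    [d] comes back to [R], while the eigenvectors in [P] stay complex. *)
Lemma symmetric_spectral n (A : 'M[R]_n) : A^T = A ->
  exists (P : 'M[R[i]]_n) (d : 'rV[R]_n),
    P \is unitarymx /\ MtoC A = P^t* *m diag_mx (MtoC d) *m P.
Proof.
move=> symA.
have hermA : MtoC A \is hermsymmx.
  by apply/is_hermitianmxP; rewrite expr0 scale1r conj_map_real symA.
have realD := hermitian_spectral_diag_real hermA.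
have /orthomx_spectralP eqA := hermitian_normalmx hermA.
exists (spectralmx (MtoC A)), (map_mx (@complex.Re R) (spectral_diag (MtoC A))).
split; first exact: spectral_unitarymx.
apply: (etrans eqA); rewrite invmx_unitary ?spectral_unitarymx //.
congr (_ *m diag_mx _ *m _).
by apply/matrixP => i j; rewrite !mxE RRe_real //; apply: (mxOverP realD).
Qed.

(** The two cross terms carry opposite signs of ['i]. By symmetry of [G] each is the transpose of
    the other, and they are 1 by 1 matrices, so they cancel. *)
Lemma hermitian_form_split n (G : 'M[R]_n) (v : 'rV[R[i]]_n) : G^T = G ->
  let a := map_mx (@complex.Re R) v in let b := map_mx (@complex.Im R) v in
  v *m MtoC G *m v^t* = MtoC (a *m G *m a^T + b *m G *m b^T).
Proof.
move=> symG a b.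
have vE : v = MtoC a + 'i *: MtoC b.
  by apply/matrixP => i j; rewrite !mxE [LHS]complexE complexiE.
have vsE : v^t* = MtoC a^T - 'i *: MtoC b^T.
  rewrite -!conj_map_real vE; apply/matrixP => i j.
  by rewrite !mxE rmorphD rmorphM /= conjCi mulNr.
have abE : b *m G *m a^T = a *m G *m b^T.
  have -> : b *m G *m a^T = (a *m G *m b^T)^T by rewrite !trmx_mul trmxK symG mulmxA.
  by apply/matrixP => i j; rewrite !ord1 [LHS]mxE.
rewrite vsE vE mulmxBr !mulmxDl -!scalemxAl -!scalemxAr -!map_mxM scalerA.
by rewrite -expr2 sqrCi scaleN1r abE opprD opprK addrA addrK map_mxD.
Qed.

(** Keeping only the columns in [T] leaves fewer columns than rows, hence a nonzero left kernel. *)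
Lemma kernel_vector (F : fieldType) k n (M : 'M[F]_(k, n)) (T : {set 'I_n}) :
  (#|T| < k)%N ->
  exists2 v : 'rV[F]_k, v != 0 & forall i, i \in T -> (v *m M) 0 i = 0.
Proof.
move=> ltTk; pose N := colsub (@enum_val _ [in T]) M.
have kerN0 : kermx N != 0.
  by rewrite -mxrank_eq0 mxrank_ker -lt0n subn_gt0 (leq_ltn_trans (rank_leq_col _)).
exists (nz_row (kermx N)); first by rewrite nz_row_eq0.
move=> i Ti; have /sub_kermxP /rowP/(_ (enum_rank_in Ti i)) := nz_row_sub (kermx N).
rewrite !mxE => ker_i; rewrite -[RHS]ker_i; apply: eq_bigr => j _.
by rewrite [N _ _]mxE enum_rankK_in.
Qed.

(* If the eigenvalues > c were fewer than k, some nonzero complex combination of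
   the rows of V would be orthogonal to all their eigenvectors, so its form would
   be at most c times its square norm; but the complex form is the sum of the real
   forms of the real and imaginary parts. *)
Lemma inertia_pos n (A : 'M[R]_n) (P : 'M[R[i]]_n) (d : 'rV[R]_n) k
    (V : 'M[R]_(k, n)) (c : R) :
  A^T = A -> P \is unitarymx -> MtoC A = P^t* *m diag_mx (MtoC d) *m P ->
  (forall v : 'rV_k, v != 0 ->
     c * (v *m V *m (v *m V)^T) 0 0 < (v *m V *m A *m (v *m V)^T) 0 0) ->
  (k <= #|[set i | (c < d 0 i)%R]|)%N.
Proof.
move=> symA unitP eqA posV; rewrite leqNgt; apply/negP => ltk.
have [v v_neq0 zE] := kernel_vector (MtoC V *m P^t* ) ltk.
set z := v *m (MtoC V *m P^t* ) in zE.
pose G := V *m (A - c%:M) *m V^T.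
have symG : G^T = G.
  have symB : (A - c%:M)^T = A - c%:M by rewrite linearB /= symA tr_scalar_mx.
  by rewrite /G !trmx_mul trmxK symB mulmxA.
have posG (u : 'rV[R]_k) : 0 <= (u *m G *m u^T) 0 0 ?= iff (u == 0).
  have -> : (u *m G *m u^T) 0 0 =
      (u *m V *m A *m (u *m V)^T) 0 0 - c * (u *m V *m (u *m V)^T) 0 0.
    rewrite /G mulmxBr !(mulmxBl, mulmxBr) trmx_mul !mulmxA mul_mx_scalar.
    by rewrite -!scalemxAl [LHS]mxE [X in _ + X]mxE [X in _ - X]mxE.
  apply/leifP; case: eqP => [->|/eqP/posV]; last by rewrite subr_gt0.
  by rewrite !mul0mx !mxE mulr0 subr0.
have := hermitian_form_split v symG.
move=> /matrixP/(_ 0 0); rewrite [RHS]mxE.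
set a := map_mx _ v; set b := map_mx _ v => formE.
have : 0 < (v *m MtoC G *m v^t* ) 0 0.
  rewrite formE ltcR mxE lt_def addr_ge0 ?posG // andbT paddr_eq0 ?posG //.
  apply: contra_neqN v_neq0 => /andP[]; rewrite ![_ == 0]eq_sym !posG.
  move=> /eqP a0 /eqP b0; apply/matrixP => i j.
  move/matrixP/(_ i j): a0; move/matrixP/(_ i j): b0; rewrite !mxE.
  by case: (v i j) => x y /= -> ->.
have -> : v *m MtoC G *m v^t* = z *m diag_mx (MtoC (d - const_mx c)) *m z^t*.
  have BE : MtoC (A - c%:M) = P^t* *m diag_mx (MtoC (d - const_mx c)) *m P.
    rewrite !map_mxB map_scalar_mx eqA map_const_mx linearB /= mulmxBr mulmxBl.
    congr (_ - _); rewrite diag_const_mx mul_mx_scalar -scalemxAl.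
    by rewrite -invmx_unitary // mulVmx ?unitarymx_unit // scalemx1.
  rewrite /G !map_mxM BE /z !(trmx_mul, map_mxM) /= trmxCK conj_map_real.
  by rewrite !mulmxA.
clearbody z; suff le0 : (z *m diag_mx (MtoC (d - const_mx c)) *m z^t* ) 0 0 <= 0.
  by move=> /lt_le_trans/(_ le0); rewrite ltxx.
rewrite mul_mx_diag mxE sumr_le0 // => i _; rewrite !mxE mulrAC -normCK.
have [lt_c|le_c] := ltP c (d 0 i); first by rewrite zE ?inE // normr0 expr0n mul0r.
by rewrite mulr_ge0_le0 ?exprn_ge0 // lecE /= eqxx subr_le0.
Qed.

(** [P] conjugates the complexified matrix to a diagonal one, and equality of polynomials descends
    to [R] by injectivity of [toC]. *)
Lemma char_poly_spectral n (A : 'M[R]_n) (P : 'M[R[i]]_n) (d : 'rV[R]_n) :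
  P \is unitarymx -> MtoC A = P^t* *m diag_mx (MtoC d) *m P ->
  char_poly A = \prod_i ('X - (d 0 i)%:P).
Proof.
move=> unitP eqA; apply: (map_poly_inj toC).
rewrite map_char_poly rmorph_prod /= eqA -invmx_unitary //.
have polyE : char_poly_mx (invmx P *m diag_mx (MtoC d) *m P) =
    map_mx polyC (invmx P) *m char_poly_mx (diag_mx (MtoC d)) *m map_mx polyC P.
  rewrite /char_poly_mx mulmxBr mulmxBl !map_mxM; congr (_ - _).
  rewrite mul_mx_scalar -scalemxAl -map_mxM mulVmx ?unitarymx_unit //.
  by rewrite map_mx1 scalemx1.
rewrite /char_poly polyE !det_mulmx mulrAC -det_mulmx -map_mxM.
rewrite mulVmx ?unitarymx_unit // map_mx1 det1 mul1r -/(char_poly _).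
rewrite char_poly_trig ?diag_mx_is_trig //; apply: eq_bigr => i _.
by rewrite rmorphB /= map_polyX map_polyC /= !mxE eqxx mulr1n.
Qed.

Lemma mup_prod_XsubC (I : finType) (F : I -> R) x :
  mup x (\prod_i ('X - (F i)%:P)) = #|[set i | F i == x]|.
Proof.
have -> : #|[set i | F i == x]| = (\sum_i (F i == x))%N.
  by rewrite -sum1_card big_mkcond; apply: eq_bigr => i _; rewrite inE; case: eqP.
have prod_neq0 (r : seq I) : \prod_(i <- r) ('X - (F i)%:P) != 0.
  by rewrite prodf_seq_neq0; apply/allP => i _; rewrite polyXsubC_eq0.
elim: (index_enum I) => [|i r IHr]; first by rewrite !big_nil mupNroot // root1.
rewrite !big_cons mupM ?polyXsubC_eq0 // IHr.
by rewrite -['X - _]expr1 mup_XsubCX; case: eqP.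
Qed.

Lemma eigenvalues_sorted n (A : 'M[R]_n) : sorted >=%R (eigenvalues A).
Proof.
rewrite /eigenvalues rev_sorted /rootsR.
set p := char_poly A; set s := roots _ _ _.
have : pairwise <%R s by rewrite -lt_sorted_pairwise; exact: sorted_roots.
suff pw : pairwise <%R s -> pairwise <=%R (flatten [seq nseq (mup x p) x | x <- s]).
  by move=> /pw; rewrite -le_sorted_pairwise.
elim: s => //= x s IHs /andP[/allP ltx /IHs {}IHs]; rewrite pairwise_cat IHs andbT.
apply/andP; split; last first.
  by rewrite -le_sorted_pairwise; elim: (mup x p) => [|[|m]] //= IHm; rewrite lexx.
apply/allrelP => y z /nseqP[-> _] /flattenP[_ /mapP[w sw ->] /nseqP[-> _]].
exact/ltW/ltx.
Qed.

Lemma count_image (I : finType) (f : I -> R) (a : pred R) :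
  count a [seq f i | i : I] = #|[set i | a (f i)]|.
Proof.
rewrite count_map -sum1_count big_enum_cond -sum1_card.
by apply: eq_bigl => i; rewrite inE.
Qed.

(** Both lists contain each [x] as often as its multiplicity as a root of [char_poly A]. *)
Lemma eigenvalues_perm n (A : 'M[R]_n) (P : 'M[R[i]]_n) (d : 'rV[R]_n) :
  P \is unitarymx -> MtoC A = P^t* *m diag_mx (MtoC d) *m P ->
  perm_eq (eigenvalues A) [seq d 0 i | i : 'I_n].
Proof.
move=> unitP eqA; have pE := char_poly_spectral unitP eqA.
have p_neq0 : char_poly A != 0 by rewrite monic_neq0 ?char_poly_monic.
apply/allP => x _; apply/eqP.
rewrite count_rev count_flatten -map_comp sumnE big_map.
under eq_bigr => y _ do rewrite /= count_nseq /=.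
have -> : count_mem x [seq d 0 i | i : 'I_n] = mup x (char_poly A).
  by rewrite pE mup_prod_XsubC count_image.
have rootsE y : y \in rootsR (char_poly A) = root (char_poly A) y.
  by have := roots_on_rootsR p_neq0 y; rewrite in_itv /= => ->.
have [root_x|nroot_x] := boolP (root (char_poly A) x); last first.
  rewrite mupNroot // big1_seq // => y; rewrite rootsE => root_y.
  by case: eqP => // yx; rewrite yx (negPf nroot_x) in root_y.
rewrite (bigD1_seq x) /= ?rootsE ?uniq_roots // eqxx mul1n big1 ?addn0 // => y /negPf ->.
by [].
Qed.

Lemma size_eigenvalues n (A : 'M[R]_n) : A^T = A -> size (eigenvalues A) = n.
Proof.
move=> /symmetric_spectral[P [d [unitP eqA]]].
by rewrite (perm_size (eigenvalues_perm unitP eqA)) size_map -cardE card_ord.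
Qed.

(** If the [k]-th entry were at most [c], so would be all later ones, leaving at most [k - 1]
    entries above [c]. *)
Lemma sorted_count_gt (s : seq R) (c : R) k :
  sorted >=%R s -> (0 < k)%N -> (k <= count (> c) s)%N -> c < s`_k.-1.
Proof.
move=> sorted_s k_gt0 le_k; rewrite ltNge; apply/negP => le_c; move: (le_k).
have ltks : (k.-1 < size s)%N.
  rewrite (leq_trans _ (count_size (> c) s)) // prednK //.
rewrite -[s in count _ s](cat_take_drop k.-1) count_cat.
rewrite (_ : count _ (drop _ _) = 0%N) ?addn0.
  move=> /leq_trans/(_ (count_size _ _)).
  by rewrite size_take ltks -ltnS prednK // ltnn.
apply/eqP; rewrite -leqn0 leqNgt -has_count; apply/hasPn => x /(nthP 0)[j].
rewrite size_drop nth_drop => ltj <-; rewrite -leNgt (le_trans _ le_c) //.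
apply: (sorted_leq_nth ge_trans) => //; rewrite ?inE ?leq_addr //.
  exact: lexx.
by rewrite -ltn_subRL.
Qed.

(** If the [k]-th entry were at least [c], so would be the first [k], leaving at most [size s - k]
    entries below [c]. The bound [k <= size s] keeps the default value of [nth] out. *)
Lemma sorted_count_lt (s : seq R) (c : R) k :
  sorted >=%R s -> (0 < k <= size s)%N -> (size s < k + count (< c) s)%N ->
  s`_k.-1 < c.
Proof.
move=> sorted_s /andP[k_gt0 le_k] lt_s; rewrite ltNge; apply/negP => le_c.
move: lt_s; rewrite ltnNge => /negP[].
rewrite -[s in count _ s](cat_take_drop k) count_cat (_ : count _ (take _ _) = 0%N).
  by rewrite add0n -(subnKC le_k) leq_add2l -size_drop count_size.
apply/eqP; rewrite -leqn0 leqNgt -has_count; apply/hasPn => x /(nthP 0)[j].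
rewrite size_takel // => ltj <-; rewrite nth_take // -leNgt (le_trans le_c) //.
apply: (sorted_leq_nth ge_trans) => //; rewrite ?inE.
- exact: lexx.
- exact: leq_trans le_k.
- by rewrite prednK.
- by rewrite -ltnS prednK.
Qed.

Lemma lambda_gt n (A : 'M[R]_n) k (V : 'M[R]_(k, n)) (c : R) :
  A^T = A -> (0 < k)%N ->
  (forall v : 'rV_k, v != 0 ->
     c * (v *m V *m (v *m V)^T) 0 0 < (v *m V *m A *m (v *m V)^T) 0 0) ->
  c < lambda k A.
Proof.
move=> symA k_gt0 posV; have [P [d [unitP eqA]]] := symmetric_spectral symA.
apply: sorted_count_gt => //; first exact: eigenvalues_sorted.
rewrite (permP (eigenvalues_perm unitP eqA)).
have := inertia_pos symA unitP eqA posV; move=> /leq_trans; apply.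
by rewrite count_image.
Qed.

(** [inertia_pos] for [- A], whose eigenvalues are [- d]: at least [m > n - k] eigenvalues lie below
    [c]. *)
Lemma lambda_lt n (A : 'M[R]_n) k m (V : 'M[R]_(m, n)) (c : R) :
  A^T = A -> (0 < k <= n)%N -> (n < k + m)%N ->
  (forall v : 'rV_m, v != 0 ->
     (v *m V *m A *m (v *m V)^T) 0 0 < c * (v *m V *m (v *m V)^T) 0 0) ->
  lambda k A < c.
Proof.
move=> symA k_bounds lt_n negV; have [P [d [unitP eqA]]] := symmetric_spectral symA.
apply: sorted_count_lt; rewrite ?size_eigenvalues //; first exact: eigenvalues_sorted.
rewrite (permP (eigenvalues_perm unitP eqA)) count_image.
apply: (leq_trans lt_n); rewrite leq_add2l.
have -> : [set i | d 0 i < c] = [set i | - c < (- d) 0 i].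
  by apply/setP => i; rewrite !inE mxE ltrN2.
apply: (inertia_pos (A := - A) (P := P) (V := V)) => //.
- by rewrite linearN /= symA.
- by rewrite !map_mxN eqA linearN /= mulmxN mulNmx.
move=> v /negV; rewrite mulmxN mulNmx mulNr => lt_v.
by rewrite [X in _ < X]mxE ltrN2.
Qed.

Lemma sqnorm_gt0 n (y : 'rV[R]_n) : y != 0 -> 0 < (y *m y^T) 0 0.
Proof.
move=> /rV0Pn[i yi]; rewrite mxE (bigD1 i) //= mxE -expr2.
rewrite ltr_pwDl ?exprn_even_gt0 //.
by apply: sumr_ge0 => j _; rewrite mxE -expr2 sqr_ge0.
Qed.

(** The strict version is applied with [lambda k A] itself as the constant: if it were below [c], it
    would be below itself. Freeness of [V] keeps the square norms positive. *)
Lemma lambda_ge n (A : 'M[R]_n) k (V : 'M[R]_(k, n)) (c : R) :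
  A^T = A -> (0 < k)%N -> row_free V ->
  (forall v : 'rV_k,
     c * (v *m V *m (v *m V)^T) 0 0 <= (v *m V *m A *m (v *m V)^T) 0 0) ->
  c <= lambda k A.
Proof.
move=> symA k_gt0 freeV nnegV; rewrite leNgt; apply/negP => lt_c.
suff /(lambda_gt symA k_gt0) : forall v : 'rV_k, v != 0 ->
    lambda k A * (v *m V *m (v *m V)^T) 0 0 < (v *m V *m A *m (v *m V)^T) 0 0.
  by rewrite ltxx.
move=> v v0; apply: lt_le_trans (nnegV v).
by rewrite ltr_pM2r // sqnorm_gt0 // mulmx_free_eq0.
Qed.

Lemma lambda_le n (A : 'M[R]_n) k m (V : 'M[R]_(m, n)) (c : R) :
  A^T = A -> (0 < k <= n)%N -> (n < k + m)%N -> row_free V ->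
  (forall v : 'rV_m,
     (v *m V *m A *m (v *m V)^T) 0 0 <= c * (v *m V *m (v *m V)^T) 0 0) ->
  lambda k A <= c.
Proof.
move=> symA k_bounds lt_n freeV nposV; rewrite leNgt; apply/negP => lt_c.
suff /(lambda_lt symA k_bounds lt_n) : forall v : 'rV_m, v != 0 ->
    (v *m V *m A *m (v *m V)^T) 0 0 < lambda k A * (v *m V *m (v *m V)^T) 0 0.
  by rewrite ltxx.
move=> v v0; apply: le_lt_trans (nposV v) _.
by rewrite ltr_pM2r // sqnorm_gt0 // mulmx_free_eq0.
Qed.
End SymmetricSpectrum.

(** * The cyclic form and subspaces on which it has a sign *)

Section CycleForm.
Variable R : realType.

Definition cycle_form l (z : 'rV[R]_l) : R := \sum_i z 0 i * z 0 (ordS i).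

(** Indexing by natural numbers separates the wrapping product from a sum amenable to induction. *)
Lemma cycle_form_wrap p (z : 'rV[R]_p.+1) (y : nat -> R) :
  (forall i, z 0 i = y i) ->
  cycle_form z = \sum_(n < p) y n * y n.+1 + y p * y 0.
Proof.
move=> zE; rewrite /cycle_form big_ord_recr /= !zE /= modnn; congr (_ + _).
by apply: eq_bigr => i _; rewrite !zE /= modn_small // ltnS.
Qed.

(** The extension of [v] by zero, written with Kronecker deltas so as to match an entry of a product
    with a 0/1 matrix. *)
Definition pad k (v : 'rV[R]_k) (n : nat) : R := \sum_j v 0 j * (j == n :> nat)%:R.

Lemma pad_ge k (v : 'rV[R]_k) n : (k <= n)%N -> pad v n = 0.
Proof.
move=> le_kn; apply: big1 => j _.
by rewrite ltn_eqF ?mulr0 // (leq_trans (ltn_ord j)).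
Qed.

Lemma pad_eq0 k (v : 'rV[R]_k) : (forall n, (n < k)%N -> pad v n = 0) -> v = 0.
Proof.
move=> pad0; apply/rowP => i; rewrite mxE -(pad0 i) // /pad (bigD1 i) //= eqxx mulr1.
by rewrite big1 ?addr0 // => j /negPf ji; rewrite -val_eqE /= in ji; rewrite ji mulr0.
Qed.

(* The sum of the products of consecutive terms of a_0, a_0, a_1, a_1, ..., a_(m-1),
   a_(m-1), a_m. *)
Definition pair_form (a : nat -> R) m := \sum_(i < m) (a i ^+ 2 + a i * a i.+1).

(** Twice each summand is [(a_i + a_(i+1))^2 + a_i^2 - a_(i+1)^2], and the differences telescope. *)
Lemma pair_form_sos a m :
  2 * pair_form a m = a 0%N ^+ 2 - a m ^+ 2 + \sum_(i < m) (a i + a i.+1) ^+ 2.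
Proof.
rewrite /pair_form; elim: m => [|m IHm]; first by rewrite !big_ord0; ring.
by rewrite !big_ord_recr /= mulrDr IHm; ring.
Qed.

Lemma pair_form_ge0 a m : a m ^+ 2 <= a 0%N ^+ 2 -> 0 <= pair_form a m.
Proof.
move=> le_am; rewrite -(pmulr_rge0 _ (ltr0Sn R 1)) pair_form_sos.
by rewrite addr_ge0 ?subr_ge0 // sumr_ge0 // => i _; exact: sqr_ge0.
Qed.

(** All the squares in [pair_form_sos] must vanish, which forces [a_(i+1) = - a_i]. *)
Lemma pair_form_eq0 a m : a m ^+ 2 <= a 0%N ^+ 2 -> pair_form a m = 0 ->
  forall i, (i <= m)%N -> a i = (-1) ^+ i * a 0%N.
Proof.
move=> le_am form0 i le_im.
have sum_ge0 : 0 <= \sum_(i < m) (a i + a i.+1) ^+ 2.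
  by rewrite sumr_ge0 // => j _; exact: sqr_ge0.
have sum0 : \sum_(i < m) (a i + a i.+1) ^+ 2 = 0.
  by have := pair_form_sos a m; rewrite form0; lra.
elim: i le_im => [|i IHi] lt_im; first by rewrite mul1r.
move/psumr_eq0P: sum0 => /(_ (fun j _ => sqr_ge0 _) (Ordinal lt_im) isT)/eqP.
by rewrite sqrf_eq0 addrC addr_eq0 IHi 1?ltnW // => /eqP ->; rewrite exprS; ring.
Qed.

(* The multiple b of the sequence +, -, -, +, +, -, -, ... is added: on a cycle of
   length 4j+1 it is orthogonal, for [cycle_form], to the vectors constant on the pairs. *)
Definition pair_seq (a : nat -> R) (b : R) n := a n./2 + (-1) ^+ (n./2 + odd n) * b.

Lemma pair_seq_even a b i : pair_seq a b i.*2 = a i + (-1) ^+ i * b.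
Proof. by rewrite /pair_seq doubleK odd_double addn0. Qed.

Lemma pair_seq_odd a b i : pair_seq a b i.*2.+1 = a i - (-1) ^+ i * b.
Proof. by rewrite /pair_seq /= uphalf_double odd_double /= addn1 exprS; ring. Qed.

(** The products at indices [2i] and [2i+1] contribute [- b^2] and [b^2], which cancel, and the
    terms linear in [b] telescope. *)
Lemma pair_seq_sum a b m :
  \sum_(n < m.*2) pair_seq a b n * pair_seq a b n.+1 =
  pair_form a m - b * (a 0%N - (-1) ^+ m * a m).
Proof.
rewrite /pair_form; elim: m => [|m IHm]; first by rewrite !big_ord0; ring.
rewrite doubleS !big_ord_recr /= IHm -doubleS !pair_seq_even pair_seq_odd exprS.
by ring.
Qed.

(** The two products involving [y_(2i+1)] add up to [(-1)^i b (a_i + a_(i+1))], which telescopes. *)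
Lemma alternating_sum (a : nat -> R) (b : R) m :
  let y n := if odd n then (-1) ^+ n./2 * b else a n./2 in
  \sum_(n < m.*2) y n * y n.+1 = b * (a 0%N - (-1) ^+ m * a m).
Proof.
move=> y; elim: m => [|m IHm]; first by rewrite !big_ord0; ring.
rewrite doubleS !big_ord_recr /= IHm /y /= odd_double /= doubleK uphalf_double exprS.
by ring.
Qed.

Definition pair_mx k l : 'M[R]_(k, l) := \matrix_(j, i) (j == i./2 :> nat)%:R.

Lemma mul_pair_mx k l (v : 'rV[R]_k) i : (v *m pair_mx k l) 0 i = pad v i./2.
Proof. by rewrite mxE; apply: eq_bigr => j _; rewrite mxE. Qed.

(** Some coordinate lies beyond the [k] pairs, so the chain ends with [a_k = 0]. If the form
    vanished, alternation of signs would make every [a_i] zero. *)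
Lemma pair_mx_pos k l (v : 'rV[R]_k) : (k.*2 < l)%N -> v != 0 ->
  0 < cycle_form (v *m pair_mx k l).
Proof.
case: l => // l; rewrite ltnS => le_kl v_neq0.
have padk : pad v k = 0 by rewrite pad_ge.
have -> : cycle_form (v *m pair_mx k l.+1) = pair_form (pad v) k.
  rewrite (cycle_form_wrap (y := pair_seq (pad v) 0)); last first.
    by move=> i; rewrite mul_pair_mx /pair_seq mulr0 addr0.
  have y0 n : (k.*2 <= n)%N -> pair_seq (pad v) 0 n = 0.
    by move=> le_n; rewrite /pair_seq mulr0 addr0 pad_ge // geq_half_double.
  rewrite y0 // mul0r addr0.
  rewrite -(big_mkord xpredT (fun n => pair_seq _ _ n * pair_seq _ _ n.+1)).
  rewrite (big_cat_nat (n := k.*2)) //= big_mkord pair_seq_sum mul0r subr0.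
  rewrite big_nat_cond big1 ?addr0 // => n /andP[/andP[le_n _] _].
  by rewrite y0 // mul0r.
have le0 : pad v k ^+ 2 <= pad v 0 ^+ 2 by rewrite padk expr0n sqr_ge0.
rewrite lt_def pair_form_ge0 // andbT; apply: contra_neq v_neq0 => form0.
have padE := pair_form_eq0 le0 form0.
have pad0 : pad v 0 = 0.
  by apply/eqP; have /eqP := padE k (leqnn k); rewrite padk eq_sym mulf_eq0 signr_eq0.
by apply: pad_eq0 => n lt_n; rewrite padE 1?ltnW // pad0 mulr0.
Qed.

Lemma pair_mx_free k l : (k.*2 <= l)%N -> row_free (pair_mx k l).
Proof.
move=> le_kl; apply: inj_row_free => v /rowP v0; apply: pad_eq0 => n lt_n.
have lt_nl : (n.*2 < l)%N by rewrite (leq_trans _ le_kl) ?ltn_double.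
by have := v0 (Ordinal lt_nl); rewrite mul_pair_mx mxE /= doubleK.
Qed.

(** Here the pairs fill the whole cycle; reduction modulo [k] makes the last pair adjacent to the
    first. *)
Lemma cycle_form_pair_mx k (v : 'rV[R]_k) : (0 < k)%N ->
  cycle_form (v *m pair_mx k k.*2) = pair_form (fun i => pad v (i %% k)) k.
Proof.
case: k v => // k v _; rewrite doubleS.
set a := fun i => _.
rewrite (cycle_form_wrap (y := pair_seq a 0)); last first.
  move=> i; rewrite mul_pair_mx /pair_seq mulr0 addr0 /a modn_small //.
  by rewrite ltn_half_double doubleS.
(* By periodicity the wrapping product becomes the last term of a straight sum. *)
have -> : pair_seq a 0 0 = pair_seq a 0 k.+1.*2.
  by rewrite pair_seq_even /pair_seq /a modnn mod0n !mulr0.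
have := pair_seq_sum a 0 k.+1; rewrite mul0r subr0 => <-.
by rewrite doubleS [RHS]big_ord_recr.
Qed.

Lemma pair_mx_nneg k l (v : 'rV[R]_k) : (k.*2 <= l)%N ->
  0 <= cycle_form (v *m pair_mx k l).
Proof.
rewrite leq_eqVlt => /orP[/eqP <-|lt_kl].
  case: k v => [|k] v; first by rewrite /cycle_form big_ord0.
  by rewrite cycle_form_pair_mx // pair_form_ge0 // modnn mod0n.
have [->|v_neq0] := eqVneq v 0; last exact/ltW/pair_mx_pos.
by rewrite mul0mx /cycle_form big1 // => i _; rewrite mxE mul0r.
Qed.

(** If the form vanished, alternating signs once around an odd number of pairs would give
    [a_0 = - a_0]. *)
Lemma pair_mx_odd_pos k (v : 'rV[R]_k) : odd k -> v != 0 ->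
  0 < cycle_form (v *m pair_mx k k.*2).
Proof.
move=> odd_k v_neq0; rewrite cycle_form_pair_mx ?odd_gt0 //.
set a := fun i => _.
have ak : a k = a 0%N by rewrite /a modnn mod0n.
have le0 : a k ^+ 2 <= a 0%N ^+ 2 by rewrite ak.
rewrite lt_def pair_form_ge0 // andbT; apply: contra_neq v_neq0 => form0.
have aE := pair_form_eq0 le0 form0.
have a0 : a 0%N = 0.
  by have := aE k (leqnn _); rewrite ak -signr_odd odd_k; lra.
by apply: pad_eq0 => n lt_n; have := aE n (ltnW lt_n); rewrite a0 mulr0 /a modn_small.
Qed.

(* Row m is the extra vector of [pair_seq].  The sign (-1)^(m n) on coordinate n makes q
   positive definite on the rows for m even, negative definite for m odd. *)
Definition odd_cycle_mx m : 'M[R]_(m.+1, m.*2.+1) :=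
  \matrix_(j, n) (((-1) ^+ m) ^+ n *
    ((j < m)%:R * (j == n./2 :> nat)%:R +
     (-1) ^+ (n./2 + odd n) * (j == m :> nat)%:R)).

(** The signs at consecutive indices multiply to [s = (-1)^m]. As [a_m = 0], the wrapping product is
    [s b (a_0 + b)]: its cross term cancels the one in [pair_seq_sum], and [s b^2] remains. *)
Lemma odd_cycle_mx_form m (v : 'rV[R]_m.+1) :
  cycle_form (v *m odd_cycle_mx m) = (-1) ^+ m *
    (pair_form (fun i => (i < m)%:R * pad v i) m + pad v m ^+ 2).
Proof.
set a := fun i => _; set b := pad v m.
rewrite (cycle_form_wrap (y := fun n => ((-1) ^+ m) ^+ n * pair_seq a b n)); last first.
  move=> n; rewrite mxE /pair_seq /a /b /pad !mulr_sumr -big_split mulr_sumr.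
  apply: eq_bigr => j _; rewrite mxE /=; have [->|_] := eqVneq (j : nat) n./2.
    by rewrite /= mulr1n; ring.
  by rewrite /= mulr0n; ring.
have am : a m = 0 by rewrite /a ltnn mul0r.
set s := (-1) ^+ m.
have sqr_s : s ^+ 2 = 1 by rewrite sqrr_sign.
have s_even n : s ^+ n.*2 = 1 by rewrite -mul2n exprM sqr_s expr1n.
rewrite (eq_bigr (fun n : 'I_(m.*2) => s * (pair_seq a b n * pair_seq a b n.+1))).
  rewrite -mulr_sumr pair_seq_sum s_even pair_seq_even am -/s.
  by rewrite [pair_seq a b 0]/pair_seq /=; ring: sqr_s.
move=> n _; transitivity (s ^+ n.*2 * s * (pair_seq a b n * pair_seq a b n.+1)).
  by rewrite -(addnn n) exprD exprS; ring.
by rewrite s_even mul1r.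
Qed.

Lemma odd_cycle_mx_pos m (v : 'rV[R]_m.+1) : v != 0 ->
  0 < (-1) ^+ m * cycle_form (v *m odd_cycle_mx m).
Proof.
move=> v_neq0; rewrite odd_cycle_mx_form mulrA -expr2 sqrr_sign mul1r.
set a := fun i => _.
have le0 : a m ^+ 2 <= a 0%N ^+ 2 by rewrite /a ltnn mul0r expr0n sqr_ge0.
rewrite lt_def addr_ge0 ?pair_form_ge0 ?sqr_ge0 // andbT.
apply: contra_neq v_neq0 => /eqP; rewrite paddr_eq0 ?pair_form_ge0 ?sqr_ge0 //.
rewrite sqrf_eq0 => /andP[/eqP form0 /eqP padm].
have aE := pair_form_eq0 le0 form0.
have a0 : a 0%N = 0.
  apply/eqP; have /eqP := aE m (leqnn m).
  by rewrite {1}/a ltnn mul0r eq_sym mulf_eq0 signr_eq0.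
apply: pad_eq0 => n; rewrite ltnS leq_eqVlt => /orP[/eqP -> //|lt_n].
by have := aE n (ltnW lt_n); rewrite a0 mulr0 /a lt_n mul1r.
Qed.

(* The vectors supported on the even vertices, and a vector supported on the odd ones
   which, for m even, is in the kernel of the adjacency matrix of the cycle. *)
Definition isotropic_mx m : 'M[R]_(m.+1, m.*2) :=
  \matrix_(j, n) (if odd n then (-1) ^+ n./2 * (j == m :> nat)%:R
                  else (j == n./2 :> nat)%:R).

Lemma isotropic_mx_entry m (v : 'rV[R]_m.+1) n :
  (v *m isotropic_mx m) 0 n = if odd n then (-1) ^+ n./2 * pad v m else pad v n./2.
Proof.
rewrite mxE /pad; case: ifP => odd_n.
  by rewrite mulr_sumr; apply: eq_bigr => j _; rewrite mxE odd_n mulrCA.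
by apply: eq_bigr => j _; rewrite mxE odd_n.
Qed.

(** For [m] even the alternating signs close up around the cycle: the telescoped sum is
    [b (a_0 - a_m)], and [a_m = a_0] by periodicity. *)
Lemma isotropic_mx_form m (v : 'rV[R]_m.+1) : ~~ odd m ->
  cycle_form (v *m isotropic_mx m) = 0.
Proof.
case: m v => [|m] v even_m; first by rewrite /cycle_form big_ord0.
pose a i := pad v (i %% m.+1); pose b := pad v m.+1.
pose y n := if odd n then (-1) ^+ n./2 * b else a n./2.
rewrite (cycle_form_wrap (p := m.*2.+1) (y := y)); last first.
  move=> n; rewrite [LHS](isotropic_mx_entry v n) /y /a modn_small //.
  by rewrite ltn_half_double doubleS.
have -> : y 0 = y m.+1.*2.
  by rewrite /y odd_double doubleK /a modnn mod0n.
have := alternating_sum a b m.+1; rewrite -/y.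
rewrite {2}/a modnn -signr_odd (negPf even_m) mul1r subrr mulr0 => sum0.
by rewrite -[RHS]sum0 doubleS [RHS]big_ord_recr.
Qed.

Lemma isotropic_mx_free m : (0 < m)%N -> row_free (isotropic_mx m).
Proof.
move=> m_gt0; apply: inj_row_free => v /rowP v0; apply: pad_eq0 => n.
rewrite ltnS leq_eqVlt => /orP[/eqP ->|lt_n].
  (* Coordinate 1 reads off the coefficient of the extra row [m]; coordinate [2n] reads off that of
     row [n]. *)
  have lt1 : (1 < m.*2)%N by rewrite -(ltn_double 0) in m_gt0; lia.
  by have := v0 (Ordinal lt1); rewrite isotropic_mx_entry mxE /= mul1r.
have lt_nm : (n.*2 < m.*2)%N by rewrite ltn_double.
by have := v0 (Ordinal lt_nm); rewrite isotropic_mx_entry mxE /= odd_double doubleK.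
Qed.

End CycleForm.

(** * Cycles of a graph as embeddings of the standard cycle *)

Lemma cycle_adjE l (i j : 'I_l) : (2 < l)%N ->
  cycle_adj i j = ((j == ordS i) + (i == ordS j))%N :> nat.
Proof.
move=> l_gt2; rewrite /cycle_adj -!val_eqE /=.
have modE (x : 'I_l) : (x.+1 %% l = if x.+1 == l then 0 else x.+1)%N.
  case: eqP => [->|neq]; rewrite ?modnn // modn_small // ltn_neqAle ltn_ord andbT.
  exact/eqP.
(* As [l > 2], [j] cannot both follow and precede [i], so the disjunction is a sum. *)
rewrite !modE; have := ltn_ord i; have := ltn_ord j.
by case: ifP => /eqP ?; case: ifP => /eqP ?; lia.
Qed.

Lemma cycle_nthP (T : Type) (e : rel T) x0 (p : seq T) :
  reflect (forall i, (i < size p)%N -> e (nth x0 p i) (nth x0 p (i.+1 %% size p)%N))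
          (cycle e p).
Proof.
case: p => [|x p]; first by apply: ReflectT.
rewrite /cycle; apply: (iffP (pathP x0)); rewrite size_rcons => step i lt_i.
  have := step i lt_i; rewrite -rcons_cons nth_rcons /= lt_i nth_rcons.
  have [lt_ip|ge_ip] := ltnP i (size p); first by rewrite modn_small.
  have -> : i = size p by apply/eqP; rewrite eqn_leq ge_ip andbT -ltnS.
  by rewrite eqxx modnn.
have := step i lt_i; rewrite -rcons_cons !nth_rcons /= lt_i.
have [lt_ip|ge_ip] := ltnP i (size p); first by rewrite modn_small.
have -> : i = size p by apply/eqP; rewrite eqn_leq ge_ip andbT -ltnS.
by rewrite eqxx modnn.
Qed.

(** Adjacency is preserved but not reflected: the cycle may have chords in [G]. *)
Definition cycle_embedding (G : sgraph) l (f : 'I_l -> G) :=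
  injective f /\ forall i j, cycle_adj i j -> adj (f i) (f j).

Lemma circumference_embedding (G : sgraph) : (0 < circumference G)%N ->
  (2 < circumference G)%N /\ exists f : 'I_(circumference G) -> G, cycle_embedding f.
Proof.
(* The maximum is either its initial value 0, excluded by the guard, or attained by a cycle. *)
rewrite /circumference; apply: (big_ind (fun c => (0 < c)%N ->
    (2 < c)%N /\ exists f : 'I_c -> G, cycle_embedding f)) => //.
  by move=> m n Hm Hn; rewrite /maxn; case: ifP.
move=> l /existsP[p /and3P[l_gt2 /= cyc_p uniq_p]] _; split=> //.
exists (tnth p); split.
  by apply/injectiveP; rewrite /injectiveb /dinjectiveb map_tnth_enum.
have x0 := tnth p (Ordinal (leq_trans (isT : (0 < 3)%N) l_gt2)).
have step (i : 'I_l) : adj (tnth p i) (tnth p (ordS i)).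
  rewrite !(tnth_nth x0); have /(cycle_nthP _ x0) := cyc_p.
  by rewrite size_tuple => /(_ i (ltn_ord i)).
move=> i j; rewrite /cycle_adj => /andP[_] /orP[] /eqP ij.
  by have -> : j = ordS i by exact: val_inj.
by rewrite adj_sym; have -> : i = ordS j by exact: val_inj.
Qed.

Lemma leq_circumference (G : sgraph) l (f : 'I_l -> G) : (2 < l)%N ->
  cycle_embedding f -> (l <= circumference G)%N.
Proof.
move=> l_gt2 [inj_f hom_f].
have le_l : (l < #|G|.+1)%N by rewrite ltnS -[X in (X <= _)%N]card_ord (leq_card f).
rewrite /circumference; apply: (bigop.bigmax_sup (Ordinal le_l)) => //.
pose p := [tuple f i | i < l].
apply/existsP; exists p; rewrite l_gt2 /= /ucycleb map_inj_uniq // enum_uniq andbT.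
have i0 : 'I_l by exists 0%N; apply: leq_trans l_gt2.
have pE (j : 'I_l) : nth (f i0) p j = f j by rewrite -tnth_nth tnth_mktuple.
apply/(cycle_nthP _ (f i0)) => i; rewrite size_tuple card_ord => lt_i.
rewrite (pE (Ordinal lt_i)) (pE (ordS (Ordinal lt_i))); apply: hom_f.
have := cycle_adjE (Ordinal lt_i) (ordS (Ordinal lt_i)) l_gt2; rewrite eqxx.
by case: cycle_adj.
Qed.

Lemma circumference_leq (G : sgraph) : (circumference G <= #|G|)%N.
Proof. by apply/bigmax_leqP => i _; rewrite -ltnS. Qed.

Lemma circumference_cycle (G : sgraph) l (f : 'I_l -> G) : (2 < l)%N ->
  bijective f -> cycle_embedding f -> circumference G = l.
Proof.
move=> l_gt2 bij_f emb_f; apply/eqP.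
rewrite eqn_leq (leq_circumference l_gt2 emb_f) andbT.
by rewrite (leq_trans (circumference_leq G)) // -(bij_eq_card bij_f) card_ord.
Qed.

Lemma isomorphic_cycle (G : sgraph) s : isomorphic G (cycle_graph s) ->
  exists2 f : 'I_s -> G, bijective f & forall i j, adj (f i) (f j) = cycle_adj i j.
Proof.
case=> h [f hK fK] mono_h; exists f; first by exists h.
by move=> i j; rewrite -mono_h !fK.
Qed.

(** * The quadratic form of [Aalpha] on vectors supported on a cycle *)

Section QuadraticForm.
Variables (R : realType) (G : sgraph) (alpha : R).

Lemma Aalpha_sym : (Aalpha alpha G)^T = Aalpha alpha G.
Proof.
rewrite linearD !linearZ /= tr_diag_mx; congr (_ + _ *: _).
by apply/matrixP => i j; rewrite !mxE adj_sym.
Qed.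

(** Row [i] is the basis vector of the vertex [f i]; for [f] injective, [z *m embed_mx f] is [z]
    carried to the image of [f] and extended by zero. *)
Definition embed_mx l (f : 'I_l -> G) : 'M[R]_(l, #|G|) :=
  rowsub (enum_rank \o f) 1%:M.

Lemma embed_mx_mul l (f : 'I_l -> G) (M : 'M[R]_#|G|) :
  embed_mx f *m M *m (embed_mx f)^T = mxsub (enum_rank \o f) (enum_rank \o f) M.
Proof.
rewrite /embed_mx mul_rowsub_mx mul1mx.
by apply/matrixP => i j; rewrite !mxE (bigD1 (enum_rank (f j))) //= !mxE eqxx mulr1
  big1 ?addr0 // => k /negPf kj; rewrite !mxE eq_sym kj mulr0.
Qed.

Lemma embed_mx_sqnorm l (f : 'I_l -> G) (z : 'rV[R]_l) : injective f ->
  (z *m embed_mx f) *m (z *m embed_mx f)^T = z *m z^T.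
Proof.
move=> inj_f; have -> : (z *m embed_mx f) *m (z *m embed_mx f)^T =
    z *m (embed_mx f *m 1%:M *m (embed_mx f)^T) *m z^T.
  by rewrite mulmx1 trmx_mul !mulmxA.
rewrite embed_mx_mul.
suff -> : mxsub (enum_rank \o f) (enum_rank \o f) 1%:M = 1%:M :> 'M[R]_l.
  by rewrite mulmx1.
by apply/matrixP => i j; rewrite !mxE (inj_eq enum_rank_inj) (inj_eq inj_f).
Qed.

Lemma embed_mx_free l (f : 'I_l -> G) : injective f -> row_free (embed_mx f).
Proof.
move=> inj_f; apply: inj_row_free => z zE0; apply/eqP/negP => /negP/sqnorm_gt0.
by rewrite -(embed_mx_sqnorm z inj_f) zE0 mul0mx mxE ltxx.
Qed.

Lemma embed_mx_form l (f : 'I_l -> G) (z : 'rV[R]_l) : injective f ->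
  (z *m embed_mx f *m Aalpha alpha G *m (z *m embed_mx f)^T) 0 0 =
  alpha * (\sum_i (degree (f i))%:R * z 0 i ^+ 2) +
  (1 - alpha) * \sum_i \sum_j (adj (f i) (f j))%:R * (z 0 i * z 0 j).
Proof.
move=> inj_f.
have -> : z *m embed_mx f *m Aalpha alpha G *m (z *m embed_mx f)^T =
    z *m (embed_mx f *m Aalpha alpha G *m (embed_mx f)^T) *m z^T.
  by rewrite trmx_mul !mulmxA.
rewrite embed_mx_mul mxE !mulr_sumr -big_split /=; apply: eq_bigr => i _.
rewrite [(z^T) i 0]mxE mxE big_distrl /= mulr_sumr.
(* The diagonal term is spread over [j] so that the two sides can be compared entry by entry. *)
have -> : alpha * ((degree (f i))%:R * z 0 i ^+ 2) =
    \sum_j alpha * (degree (f i))%:R * z 0 j * z 0 i *+ (j == i).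
  rewrite (bigD1 i) //= eqxx mulr1n big1 ?addr0; last by move=> j /negPf ->.
  by ring.
rewrite -big_split; apply: eq_bigr => j _.
rewrite !mxE !enum_rankK (inj_eq enum_rank_inj) (inj_eq inj_f) adj_sym.
by case: eqP => [->|_]; rewrite /= ?mulr1n ?mulr0n; ring.
Qed.

(** The sum runs over ordered pairs: for [w] symmetric, distinct [i] and [j] together receive [alpha
    (z_i^2 + z_j^2) + 2 (1 - alpha) z_i z_j], with weight [w i j]. *)
Definition weight_form l (w : 'I_l -> 'I_l -> R) (z : 'rV[R]_l) :=
  \sum_i \sum_j w i j * (alpha * z 0 i ^+ 2 + (1 - alpha) * (z 0 i * z 0 j)).

Lemma weight_form_ge0 l (w : 'I_l -> 'I_l -> R) (z : 'rV[R]_l) :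
  2^-1 <= alpha <= 1 -> (forall i j, w i j = w j i) -> (forall i j, 0 <= w i j) ->
  0 <= weight_form w z.
Proof.
move=> /andP[ge_a le_a] sym_w w_ge0.
(* Averaging over the exchange of i and j, as alpha >= 1/2. *)
have twice : 2 * weight_form w z = \sum_i \sum_j w i j *
    ((1 - alpha) * (z 0 i + z 0 j) ^+ 2 + (2 * alpha - 1) * (z 0 i ^+ 2 + z 0 j ^+ 2)).
  rewrite mulr_natl mulr2n {2}/weight_form exchange_big -big_split /=.
  apply: eq_bigr => i _; rewrite -big_split /=; apply: eq_bigr => j _.
  by rewrite (sym_w j i); ring.
rewrite -(pmulr_rge0 _ (ltr0Sn R 1)) twice.
apply: sumr_ge0 => i _; apply: sumr_ge0 => j _; apply: mulr_ge0 => //.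
apply: addr_ge0; apply: mulr_ge0; rewrite ?sqr_ge0 //; try lra.
by apply: addr_ge0; exact: sqr_ge0.
Qed.

Lemma weight_form_cycle l (z : 'rV[R]_l) : (2 < l)%N ->
  weight_form (fun i j => (cycle_adj i j)%:R) z =
  2 * alpha * (z *m z^T) 0 0 + 2 * (1 - alpha) * cycle_form z.
Proof.
move=> l_gt2; rewrite /weight_form.
under eq_bigr => i _.
  under eq_bigr => j _ do rewrite cycle_adjE // natrD mulrDl.
  rewrite big_split /=; over.
rewrite big_split /= [X in _ + X]exchange_big /=.
have kron (F : 'I_l -> 'I_l -> R) :
    \sum_i \sum_j (j == ordS i)%:R * F i j = \sum_i F i (ordS i).
  apply: eq_bigr => i _; rewrite (bigD1 (ordS i)) //= eqxx mul1r big1 ?addr0 //.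
  by move=> j /negPf ->; rewrite mul0r.
rewrite kron (kron (fun j i => alpha * z 0 i ^+ 2 + (1 - alpha) * (z 0 i * z 0 j))).
rewrite !big_split /= -!mulr_sumr.
have -> : \sum_i z 0 (ordS i) ^+ 2 = \sum_i z 0 i ^+ 2.
  by rewrite [RHS](reindex_inj (@ordS_inj l)).
have -> : \sum_i z 0 (ordS i) * z 0 i = cycle_form z.
  by apply: eq_bigr => i _; rewrite mulrC.
have -> : (z *m z^T) 0 0 = \sum_i z 0 i ^+ 2.
  by rewrite mxE; apply: eq_bigr => i _; rewrite mxE.
by rewrite -/(cycle_form z); ring.
Qed.

Lemma card_neighbours l (f : 'I_l -> G) i :
  #|[set j | adj (f i) (f j)]| = (\sum_j adj (f i) (f j))%N.
Proof.
rewrite -sum1_card big_mkcond; apply: eq_bigr => j _; rewrite inE.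
by case: adj.
Qed.

Lemma degree_ge l (f : 'I_l -> G) i : injective f ->
  (\sum_j adj (f i) (f j) <= degree (f i))%N.
Proof.
move=> inj_f; rewrite -card_neighbours // -(card_imset _ inj_f).
by apply/subset_leq_card/subsetP => y /imsetP[j]; rewrite !inE => adj_ij ->.
Qed.

Lemma degree_bij l (f : 'I_l -> G) i : bijective f ->
  degree (f i) = (\sum_j adj (f i) (f j))%N.
Proof.
move=> bij_f; have inj_f := bij_inj bij_f; case: bij_f => g fK gK.
apply/eqP; rewrite eqn_leq degree_ge // andbT -card_neighbours // -(card_imset _ inj_f).
apply/subset_leq_card/subsetP => y; rewrite inE => adj_y.
by apply/imsetP; exists (g y); rewrite ?inE gK.
Qed.

Lemma weight_form_adj l (f : 'I_l -> G) (z : 'rV[R]_l) :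
  weight_form (fun i j => (adj (f i) (f j))%:R) z =
  alpha * (\sum_i (\sum_j adj (f i) (f j))%N%:R * z 0 i ^+ 2) +
  (1 - alpha) * \sum_i \sum_j (adj (f i) (f j))%:R * (z 0 i * z 0 j).
Proof.
rewrite !mulr_sumr -big_split; apply: eq_bigr => i _.
rewrite natr_sum mulr_suml !mulr_sumr -big_split.
by apply: eq_bigr => j _ /=; ring.
Qed.

(** The chords carry the nonnegative symmetric weight [w], and edges leaving the image of [f] only
    enlarge the degrees, whose coefficient [alpha] is nonnegative. *)
Lemma embed_form_ge l (f : 'I_l -> G) (z : 'rV[R]_l) :
  2^-1 <= alpha <= 1 -> (2 < l)%N -> cycle_embedding f ->
  2 * alpha * (z *m z^T) 0 0 + 2 * (1 - alpha) * cycle_form z <=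
  (z *m embed_mx f *m Aalpha alpha G *m (z *m embed_mx f)^T) 0 0.
Proof.
move=> a_bounds l_gt2 [inj_f hom_f]; rewrite embed_mx_form // -weight_form_cycle //.
pose w i j : R := (adj (f i) (f j))%:R - (cycle_adj i j)%:R.
have w_ge0 i j : 0 <= w i j.
  by rewrite /w subr_ge0 ler_nat; case: (boolP (cycle_adj i j)) => // /hom_f ->.
have sym_w i j : w i j = w j i by rewrite /w adj_sym cycle_adj_sym.
have := weight_form_ge0 z a_bounds sym_w w_ge0.
have -> : weight_form w z = weight_form (fun i j => (adj (f i) (f j))%:R) z -
    weight_form (fun i j => (cycle_adj i j)%:R) z.
  rewrite /weight_form -sumrB; apply: eq_bigr => i _; rewrite -sumrB.
  by apply: eq_bigr => j _; rewrite mulrBl.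
rewrite subr_ge0 => /le_trans; apply; rewrite weight_form_adj.
have a_ge0 : 0 <= alpha by lra.
rewrite lerD2r ler_wpM2l // ler_sum // => i _.
by rewrite ler_wpM2r ?sqr_ge0 // ler_nat degree_ge.
Qed.

Lemma embed_form_cycle l (f : 'I_l -> G) (z : 'rV[R]_l) :
  (2 < l)%N -> bijective f -> (forall i j, adj (f i) (f j) = cycle_adj i j) ->
  (z *m embed_mx f *m Aalpha alpha G *m (z *m embed_mx f)^T) 0 0 =
  2 * alpha * (z *m z^T) 0 0 + 2 * (1 - alpha) * cycle_form z.
Proof.
move=> l_gt2 bij_f adjE; rewrite embed_mx_form; last exact: bij_inj.
under [X in alpha * X]eq_bigr => i _ do rewrite degree_bij //.
rewrite -weight_form_adj -weight_form_cycle //.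
by apply: eq_bigr => i _; apply: eq_bigr => j _; rewrite adjE.
Qed.
End QuadraticForm.

(** * Comparison of [lambda k] with [2 * alpha] through cycles *)

Section CycleEigenvalues.
Variables (R : realType) (G : sgraph) (alpha : R).

(** Positivity of [1 - alpha] carries the strict sign of [cycle_form] over to the form of [Aalpha]
    minus [2 * alpha] times the square norm. *)
Lemma lambda_gt_cycle l (f : 'I_l -> G) k (B : 'M[R]_(k, l)) :
  2^-1 <= alpha <= 1 -> alpha < 1 -> (2 < l)%N -> cycle_embedding f -> (0 < k)%N ->
  (forall v : 'rV_k, v != 0 -> 0 < cycle_form (v *m B)) ->
  2 * alpha < lambda k (Aalpha alpha G).
Proof.
move=> alpha_bounds a_lt1 l_gt2 emb_f k_gt0 posB.
apply: (lambda_gt (V := B *m embed_mx R f)) => //; first exact: Aalpha_sym.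
move=> v /posB form_gt0; rewrite mulmxA embed_mx_sqnorm; last by case: emb_f.
apply: lt_le_trans (embed_form_ge _ alpha_bounds l_gt2 emb_f).
by rewrite ltrDl !mulr_gt0 // subr_gt0.
Qed.

Lemma lambda_ge_cycle l (f : 'I_l -> G) k (B : 'M[R]_(k, l)) :
  2^-1 <= alpha <= 1 -> (2 < l)%N -> cycle_embedding f -> (0 < k)%N -> row_free B ->
  (forall v : 'rV_k, 0 <= cycle_form (v *m B)) ->
  2 * alpha <= lambda k (Aalpha alpha G).
Proof.
move=> alpha_bounds l_gt2 emb_f k_gt0 freeB nnegB; have [inj_f _] := emb_f.
apply: (lambda_ge (V := B *m embed_mx R f)) => //; first exact: Aalpha_sym.
  by rewrite /row_free mxrankMfree ?embed_mx_free.
move=> v; rewrite mulmxA embed_mx_sqnorm //.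
apply: le_trans (embed_form_ge _ alpha_bounds l_gt2 emb_f).
by rewrite lerDl !mulr_ge0 // subr_ge0; case/andP: alpha_bounds.
Qed.

Lemma lambda_lt_cycle l (f : 'I_l -> G) k m (B : 'M[R]_(m, l)) :
  alpha < 1 -> (2 < l)%N -> bijective f ->
  (forall i j, adj (f i) (f j) = cycle_adj i j) ->
  (0 < k <= l)%N -> (l < k + m)%N ->
  (forall v : 'rV_m, v != 0 -> cycle_form (v *m B) < 0) ->
  lambda k (Aalpha alpha G) < 2 * alpha.
Proof.
move=> a_lt1 l_gt2 bij_f adjE k_bounds lt_l negB.
have card_G : #|G| = l by rewrite -(bij_eq_card bij_f) card_ord.
apply: (lambda_lt (V := B *m embed_mx R f)); rewrite ?card_G //; first exact: Aalpha_sym.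
move=> v /negB form_lt0; rewrite mulmxA embed_mx_sqnorm; last exact: bij_inj.
by rewrite embed_form_cycle // gtrDl pmulr_rlt0 // mulr_gt0 // subr_gt0.
Qed.

Lemma lambda_le_cycle l (f : 'I_l -> G) k m (B : 'M[R]_(m, l)) :
  2^-1 <= alpha <= 1 -> (2 < l)%N -> bijective f ->
  (forall i j, adj (f i) (f j) = cycle_adj i j) ->
  (0 < k <= l)%N -> (l < k + m)%N -> row_free B ->
  (forall v : 'rV_m, cycle_form (v *m B) <= 0) ->
  lambda k (Aalpha alpha G) <= 2 * alpha.
Proof.
move=> alpha_bounds l_gt2 bij_f adjE k_bounds lt_l freeB nposB.
have card_G : #|G| = l by rewrite -(bij_eq_card bij_f) card_ord.
have inj_f := bij_inj bij_f.
apply: (lambda_le (V := B *m embed_mx R f)); rewrite ?card_G //; first exact: Aalpha_sym.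
  by rewrite /row_free mxrankMfree ?embed_mx_free.
move=> v; rewrite mulmxA embed_mx_sqnorm //.
rewrite embed_form_cycle // gerDl mulr_ge0_le0 // mulr_ge0 // subr_ge0.
by case/andP: alpha_bounds.
Qed.
End CycleEigenvalues.

(* The restrictions alpha < 1 are needed: for alpha = 1 the matrix is the
   diagonal degree matrix, so every eigenvalue of every cycle C_s is 2. *)
Theorem theorem1p3 (R : realType) (G : sgraph) (alpha : R) (k : nat)
    (connG : connected_graph G)
    (alpha_bounds : 2^-1 <= alpha <= 1)
    (k_bounds : (1 <= k <= #|G|)%N) :
  (~~ odd k ->
     ((alpha < 1 -> lambda k (Aalpha alpha G) = 2 * alpha ->
         (circumference G <= 2 * k)%N)
      /\ (forall t : nat, (2 <= t)%N ->
            isomorphic G (cycle_graph (4 * t)) -> k = (2 * t)%N ->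
            lambda k (Aalpha alpha G) = 2 * alpha
            /\ circumference G = (2 * k)%N))
     /\
     ((lambda k (Aalpha alpha G) < 2 * alpha ->
         (circumference G <= 2 * k - 1)%N)
      /\ (alpha < 1 -> forall t : nat, (1 <= t)%N ->
            isomorphic G (cycle_graph (4 * t + 3)) -> k = (2 * t + 2)%N ->
            lambda k (Aalpha alpha G) < 2 * alpha
            /\ circumference G = (2 * k - 1)%N)))
  /\
  (odd k ->
     (alpha < 1 -> lambda k (Aalpha alpha G) <= 2 * alpha ->
        (circumference G <= 2 * k - 2)%N)
     /\ (forall t : nat, (1 <= t)%N ->
           isomorphic G (cycle_graph (4 * t)) -> k = (2 * t + 1)%N ->
           lambda k (Aalpha alpha G) <= 2 * alpha
           /\ circumference G = (2 * k - 2)%N)).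
Proof.
have [k_gt0 _] := andP k_bounds; set lam := lambda k _.
(* The [k] pairs fit into a longest cycle with a vertex to spare. *)
have lam_gt : alpha < 1 -> (2 * k < circumference G)%N -> 2 * alpha < lam.
  move=> a_lt1 lt_c.
  have [|c_gt2 [f emb_f]] := @circumference_embedding G; first exact: leq_trans lt_c.
  apply: (lambda_gt_cycle alpha_bounds a_lt1 c_gt2 emb_f k_gt0) => v.
  by apply: pair_mx_pos; rewrite -mul2n.
have lam_ge : (2 * k <= circumference G)%N -> 2 * alpha <= lam.
  rewrite mul2n => le_c.
  have [|c_gt2 [f emb_f]] := @circumference_embedding G.
    by rewrite (leq_trans _ le_c) // double_gt0.
  apply: (lambda_ge_cycle alpha_bounds c_gt2 emb_f k_gt0 (pair_mx_free R le_c)) => v.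
  exact: pair_mx_nneg.
have lam_gt_odd : odd k -> alpha < 1 -> (2 * k - 2 < circumference G)%N ->
    2 * alpha < lam.
  move=> odd_k a_lt1 lt_c.
  have [|c_gt2 [f emb_f]] := @circumference_embedding G; first exact: leq_ltn_trans lt_c.
  (* Two lengths remain. For [2k], an odd number of pairs fills the cycle. For [2k - 1 = 2m + 1],
     [m = k - 1] is even, so [odd_cycle_mx] gives a positive definite form. *)
  have [/(lam_gt a_lt1) //|le_c] := ltnP (2 * k) (circumference G).
  move: (circumference G) f emb_f lt_c c_gt2 le_c => c f emb_f lt_c c_gt2.
  rewrite leq_eqVlt => /orP[/eqP c_eq|c_lt].
    rewrite mul2n in c_eq; subst c.
    apply: (lambda_gt_cycle alpha_bounds a_lt1 c_gt2 emb_f k_gt0) => v.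
    exact: pair_mx_odd_pos.
  rewrite /lam; case: (k) k_gt0 odd_k lt_c c_lt => // m _ /= even_m lt_c c_lt.
  have c_eq : c = m.*2.+1 by lia.
  subst c.
  apply: (lambda_gt_cycle (B := odd_cycle_mx R m) alpha_bounds a_lt1 c_gt2 emb_f) => //.
  move=> v.
  by move=> /odd_cycle_mx_pos; rewrite -signr_odd (negPf even_m) mul1r.
(* The isotropic space has dimension [m + 1], so [k >= m] yields the required [2m < k + m + 1]. With
   [m = 2t] this serves both [k = 2t] and [k = 2t + 1]. *)
have lam_le m : ~~ odd m -> (0 < m)%N -> (m <= k <= m.*2)%N ->
    isomorphic G (cycle_graph m.*2) -> lam <= 2 * alpha.
  move=> even_m m_gt0 /andP[le_mk le_km] /isomorphic_cycle[f bij_f adjE].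
  apply: (lambda_le_cycle alpha_bounds (B := isotropic_mx R m) _ bij_f adjE).
  - by case: (m) m_gt0 even_m => [|[|n]].
  - by rewrite k_gt0.
  - by lia.
  - exact: isotropic_mx_free.
  - by move=> v; rewrite isotropic_mx_form.
have circ_iso s : (2 < s)%N -> isomorphic G (cycle_graph s) -> circumference G = s.
  move=> s_gt2 /isomorphic_cycle[f bij_f adjE]; apply: (circumference_cycle s_gt2 bij_f).
  by split=> [|i j]; [exact: bij_inj | rewrite adjE].
have circ4 t : (1 <= t)%N -> isomorphic G (cycle_graph (4 * t)) ->
    circumference G = (4 * t)%N /\ ((2 * t <= k <= 4 * t)%N -> lam <= 2 * alpha).
  move=> t_ge1 iso; split; first by apply: circ_iso => //; lia.
  move=> k_range; have t4E : (4 * t = (2 * t).*2)%N by lia.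
  rewrite t4E in iso k_range.
  by apply: lam_le iso => //; rewrite ?oddM ?muln_gt0.
split=> [even_k|odd_k].
- split; split.
  + move=> a_lt1 lamE; rewrite leqNgt; apply/negP => /(lam_gt a_lt1).
    by rewrite lamE ltxx.
  + move=> t t_ge2 iso kE; have [circE lamE] := circ4 t (ltnW t_ge2) iso.
    have circ2k : circumference G = (2 * k)%N by lia.
    split=> //; apply/eqP; rewrite eq_le lam_ge ?circ2k // andbT.
    by apply: lamE; lia.
  + move=> lam_lt; suff : (circumference G < 2 * k)%N by lia.
    by rewrite ltnNge; apply/negP => /lam_ge; rewrite leNgt lam_lt.
  + move=> a_lt1 t t_ge1 iso kE; split; last by rewrite (circ_iso _ _ iso); lia.
    (* With [m = 2t + 1] odd, the form is negative definite in dimension [m + 1 = 2t + 2], and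
       [k + m + 1 = 4t + 4] exceeds the number of vertices. *)
    have sE : (4 * t + 3 = (2 * t + 1).*2.+1)%N by lia.
    rewrite sE in iso; have [f bij_f adjE] := isomorphic_cycle iso.
    pose B := odd_cycle_mx R (2 * t + 1).
    apply: (lambda_lt_cycle (B := B) a_lt1 _ bij_f adjE); try by lia.
    move=> v /odd_cycle_mx_pos; rewrite -signr_odd oddD oddM /= mulN1r.
    by rewrite oppr_gt0.
split=> [a_lt1 le_lam|t t_ge1 iso kE].
  by rewrite leqNgt; apply/negP => /(lam_gt_odd odd_k a_lt1); rewrite ltNge le_lam.
have [circE lamE] := circ4 t t_ge1 iso.
by split; [apply: lamE; lia | lia].
Qed.
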